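(* Let $\mathbb F$ be a field and $n\ge3$ an integer with $n\le|\mathbb F|^2+|\mathbb F|+1$ (no restriction if $\mathbb F$ is infinite). Let $P_1=[u_1],\dots,P_n=[u_n]$ be $n$ distinct points of $\mathrm{PG}(2,\mathbb F)$ ($u_i\in\mathbb F^3\setminus\{0\}$), and for each $i\in\{1,\dots,n-1\}$ choose a point $Q_i=[v_i]$ not on the line $\langle P_i,P_{i+1}\rangle$. Let $H=(u_1\mid v_1\mid u_2\mid\cdots\mid v_{n-1}\mid u_n)\in\mathrm{Mat}(3,2n-1,\mathbb F)$, let $\mathcal D=\{x\in\mathbb F^{2n-1}:Hx^T=0\}$, and let $$\mathcal C=\varrho^{-1}(\mathcal D)\oplus\phi_{1,3}(\mathrm{U}(n-2,\mathbb F)).$$ Then $\mathcal C$ is an $\{n,\frac{n(n+1)}{2}-3,3\}_{\mathbb F}$ maximum flag-rank distance code. Furthermore, an $\{n,\frac{n(n+1)}{2}-3,3\}_{\mathbb F}$ MFRD code exists if and only if $n\le|\mathbb F|^2+|\mathbb F|+1$.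
   Context: $\mathrm{U}(m,\mathbb F)$ is the space of $m\times m$ upper triangular matrices over $\mathbb F$. For $M\in\mathrm{U}(n,\mathbb F)$, $M_{[i]}$ is the submatrix with rows $1,\dots,i$ and columns $i,\dots,n$, and $\mathrm{w}_{\mathrm{fr}}(M)=\sum_{i=1}^n\operatorname{rk}(M_{[i]})$. An $\{n,t,\delta\}_{\mathbb F}$ code is a $t$-dimensional subspace of $\mathrm{U}(n,\mathbb F)$ whose minimum $\mathrm{w}_{\mathrm{fr}}$ over nonzero elements is $\delta$; it is maximum flag-rank distance (MFRD) if $t=n(n+1)/2-g(\delta)$ with $g(\delta)=\delta-1+\lfloor\sqrt{\delta-1}\rfloor\cdot\lfloor(\sqrt{4(\delta-1)+1}-1)/2\rfloor$ (so $g(3)=3$). $\mathrm{D}(2,n,\mathbb F)$ is the subspace of $\mathrm{U}(n,\mathbb F)$ of matrices $(a_{ij})$ with $a_{ij}=0$ whenever $j-i\ge2$, and $\varrho:\mathrm{D}(2,n,\mathbb F)\to\mathbb F^{2n-1}$, $\varrho(A)=(a_{11},a_{12},a_{22},a_{23},\dots,a_{n-1,n},a_{nn})$ (coordinate $2i-1$ is $a_{ii}$, coordinate $2i$ is $a_{i,i+1}$). $\phi_{1,3}:\mathrm{Mat}(n-2,\mathbb F)\to\mathrm{Mat}(n,\mathbb F)$ places an $(n-2)\times(n-2)$ matrix in rows $1,\dots,n-2$ and columns $3,\dots,n$, with zeros elsewhere. $\mathrm{PG}(2,\mathbb F)$ is the projective plane over $\mathbb F$; $[u]$ is the point spanned by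 $u$. *)

(* Defs.v *)
From HB Require Import structures.
From mathcomp Require Import all_boot all_order all_algebra all_field.

Set Implicit Arguments.
Unset Strict Implicit.
Unset Printing Implicit Defensive.

Import Order.TTheory GRing.Theory Num.Theory.
Local Open Scope ring_scope.

(* All indices are shifted to start at 0: row i of the text is row i - 1. *)

Section Supports.
Variables (F : fieldType) (n : nat).
Implicit Type M : 'M[F]_n.

Definition off_support (P : rel 'I_n) M : 'M[F]_n :=
  \matrix_(i, j) (if P i j then 0 else M i j).

Fact off_support_is_linear P : linear (off_support P).
Proof.
by move=> a M N; apply/matrixP=> i j; rewrite !mxE; case: ifP; rewrite ?mulr0 ?addr0.
Qed.
HB.instance Definition _ P :=
  GRing.isLinear.Build F 'M[F]_n 'M[F]_n _ (off_support P)
    (off_support_is_linear P).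

Definition mxsupp (P : rel 'I_n) : {vspace 'M[F]_n} :=
  lker (linfun (off_support P)).

Lemma mxsuppP P M :
  reflect (forall i j, ~~ P i j -> M i j = 0) (M \in mxsupp P).
Proof.
rewrite memv_ker lfunE /=; apply: (iffP eqP) => [M0 i j /negPf nP | M0].
  by have /matrixP/(_ i j) := M0; rewrite !mxE nP.
by apply/matrixP=> i j; rewrite !mxE; case: ifPn => // /M0.
Qed.

(* U(n, F) *)
Definition upper_mx : {vspace 'M[F]_n} :=
  mxsupp (fun i j => (i <= j)%N).

(* D(2, n, F) *)
Definition bidiag_mx : {vspace 'M[F]_n} :=
  mxsupp (fun i j => (i <= j < i + 2)%N).

End Supports.

Section FlagRank.
Variables (F : fieldType) (n : nat).
Implicit Type M : 'M[F]_n.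

Fact flag_col_subproof (i : 'I_n) (b : 'I_(n - i)) : (i + b < n)%N.
Proof. by rewrite -ltn_subRL. Qed.

(* The block M_[i]. *)
Definition flag_block M (i : 'I_n) : 'M[F]_(i.+1, n - i) :=
  \matrix_(a < i.+1, b < n - i)
    M (widen_ord (ltn_ord i) a) (Ordinal (flag_col_subproof b)).

Definition flag_rank_weight M : nat :=
  (\sum_(i < n) \rank (flag_block M i))%N.

Definition is_flag_rank_code (t delta : nat) (C : {vspace 'M[F]_n}) : Prop :=
  [/\ (C <= upper_mx F n)%VS,
      \dim C = t,
      exists M, [/\ M \in C, M != 0 & flag_rank_weight M = delta]
    & forall M, M \in C -> M != 0 -> (delta <= flag_rank_weight M)%N].

End FlagRank.

(* The real square roots are taken in algC, where sqrtC of a natural number is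
   its nonnegative real square root; Num.truncn is the floor on nonnegatives. *)
Definition mfrd_defect (delta : nat) : nat :=
  let m := (delta - 1)%N in
  (m + Num.truncn (sqrtC (m%:R : algC))
       * Num.truncn ((sqrtC ((4 * m + 1)%:R : algC) - 1) / 2))%N.

Lemma mfrd_defect3 : mfrd_defect 3 = 3.
Proof.
rewrite /mfrd_defect.
have -> : sqrtC ((4 * (3 - 1) + 1)%:R : algC) = 3.
  by rewrite (_ : _%:R = 3 ^+ 2) ?sqrCK // -natrX.
have -> : ((3 - 1) / 2 : algC) = 1%:R.
  by rewrite -(natrB _ (isT : 1 <= 3)%N) divff // pnatr_eq0.
rewrite natrK muln1 (_ : Num.truncn _ = 1%N) //; apply: truncn_def.
have le12 : (1 <= 2 :> algC) && (2 < 4 :> algC).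
  by rewrite (ler_nat _ 1 2) (ltr_nat _ 2 4).
have sqrt4 : sqrtC 4 = 2 :> algC.
  by rewrite [4](_ : _ = 2 ^+ 2) ?sqrCK ?ler0n // -natrX.
rewrite -[1%:R]sqrtC1 -[ltRHS]sqrt4.
by rewrite ler_sqrtC ?ltr_sqrtC ?nnegrE ?ler0n ?ler01.
Qed.

Definition is_MFRD (F : fieldType) (n t delta : nat) (C : {vspace 'M[F]_n}) :=
  is_flag_rank_code t delta C /\
  t = ((n * (n + 1)) %/ 2 - mfrd_defect delta)%N.

Section Construction.
Variables (F : fieldType) (n : nat).

Fact half_subproof (k : 'I_(2 * n - 1)) : (k./2 < n)%N.
Proof.
by case: k => k /= lt_k; rewrite ltn_half_double -mul2n (leq_trans lt_k) ?leq_subr.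
Qed.

Fact uphalf_subproof (k : 'I_(2 * n - 1)) : (uphalf k < n)%N.
Proof.
case: k => k /= lt_k; rewrite uphalfE ltn_half_double -mul2n.
by move: lt_k; case: (2 * n)%N => [|m]; rewrite ?subn1.
Qed.

(* Coordinate k = 2i is the entry (i, i), coordinate k = 2i + 1 is the entry
   (i, i + 1). *)
Definition rho (M : 'M[F]_n) : 'rV[F]_(2 * n - 1) :=
  \row_k M (Ordinal (half_subproof k)) (Ordinal (uphalf_subproof k)).

Fact rho_is_linear : linear rho.
Proof. by move=> a M N; apply/rowP=> k; rewrite !mxE. Qed.
HB.instance Definition _ :=
  GRing.isLinear.Build F 'M[F]_n 'rV[F]_(2 * n - 1) _ rho rho_is_linear.

(* The domain of rho in the text is D(2, n, F), hence the intersection. *)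
Definition rho_preim (V : {vspace 'rV[F]_(2 * n - 1)}) : {vspace 'M[F]_n} :=
  (bidiag_mx F n :&: (linfun rho @^-1: V))%VS.

Fact phi_col_subproof (j : 'I_(n - 2)) : (2 + j < n)%N.
Proof. by rewrite -ltn_subRL. Qed.

Definition phi13 (B : 'M[F]_(n - 2)) : 'M[F]_n :=
  \sum_(i < n - 2) \sum_(j < n - 2)
    B i j *: delta_mx (widen_ord (leq_subr 2 n) i)
                      (Ordinal (phi_col_subproof j)).

Fact phi13_is_linear : linear phi13.
Proof.
move=> a M N; rewrite /phi13 scaler_sumr -big_split; apply: eq_bigr => i _ /=.
rewrite scaler_sumr -big_split; apply: eq_bigr => j _ /=.
by rewrite !mxE scalerDl scalerA.
Qed.
HB.instance Definition _ :=
  GRing.isLinear.Build F 'M[F]_(n - 2) 'M[F]_n _ phi13 phi13_is_linear.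

Lemma phi13E B (i j : 'I_(n - 2)) :
  phi13 B (widen_ord (leq_subr 2 n) i) (Ordinal (phi_col_subproof j)) = B i j.
Proof.
rewrite /phi13 summxE (bigD1 i) //= summxE (bigD1 j) //= !mxE !eqxx mulr1.
rewrite big1 ?addr0 => [|j' ne_j]; last first.
  by rewrite !mxE -!val_eqE /= eqn_add2l [(j == j' :> nat)]eq_sym (val_eqE j' j) (negPf ne_j) andbF mulr0.
rewrite big1 ?addr0 // => i' ne_i; rewrite summxE big1 // => j' _.
by rewrite !mxE -!val_eqE /= [(i == i' :> nat)]eq_sym (val_eqE i' i) (negPf ne_i) mulr0.
Qed.

Lemma phi13_out B (i j : 'I_n) : (n - 2 <= i)%N || (j < 2)%N -> phi13 B i j = 0.
Proof.
move=> out; rewrite /phi13 summxE big1 // => a _; rewrite summxE big1 // => b _.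
rewrite !mxE -!val_eqE /=; case: eqP => [ia|_]; last by rewrite mulr0.
case: eqP => [jb|_]; last by rewrite mulr0.
by move: out; rewrite ia jb leqNgt ltn_ord.
Qed.

Fact odd_half_subproof (k : 'I_(2 * n - 1)) : odd k -> (k./2 < n.-1)%N.
Proof.
by move=> odd_k; have := uphalf_subproof k; rewrite uphalf_half odd_k ltn_predRL.
Qed.

(* H = (u_0 | v_0 | u_1 | ... | v_(n-2) | u_(n-1)) *)
Definition check_mx (u : 'I_n -> 'cV[F]_3) (v : 'I_n.-1 -> 'cV[F]_3) :
    'M[F]_(3, 2 * n - 1) :=
  \matrix_(r, k)
    match boolP (odd k) with
    | AltTrue odd_k => v (Ordinal (odd_half_subproof odd_k)) r 0
    | AltFalse _ => u (Ordinal (half_subproof k)) r 0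
    end.

Lemma check_mx_even u v (i : 'I_n) (k : 'I_(2 * n - 1)) :
  k = (2 * i)%N :> nat -> col k (check_mx u v) = u i.
Proof.
move=> def_k; have even_k : ~~ odd k by rewrite def_k oddM.
apply/colP=> r; rewrite !mxE; destruct (boolP (odd k)) as [odd_k|even_k'].
  by rewrite odd_k in even_k.
by congr (u _ r _); apply: val_inj; rewrite /= def_k mul2n doubleK.
Qed.

Lemma check_mx_odd u v (i : 'I_n.-1) (k : 'I_(2 * n - 1)) :
  k = (2 * i + 1)%N :> nat -> col k (check_mx u v) = v i.
Proof.
move=> def_k; have odd_k : odd k by rewrite def_k addn1 /= oddM.
apply/colP=> r; rewrite !mxE; destruct (boolP (odd k)) as [odd_k'|even_k].
  congr (v _ r _); apply: val_inj.
  by rewrite /= def_k mul2n addn1 /= uphalf_double.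
by rewrite odd_k in even_k.
Qed.

Definition checked_by (H : 'M[F]_(3, 2 * n - 1)) : {vspace 'rV[F]_(2 * n - 1)} :=
  lker (linfun (mulmx H \o trmx)).

Lemma checked_byE H x : (x \in checked_by H) = (H *m x^T == 0).
Proof. by rewrite memv_ker lfunE. Qed.

Fact succ_subproof (i : 'I_n.-1) : (i.+1 < n)%N.
Proof. by rewrite -ltn_predRL. Qed.

(* A point [w] of PG(2, F) is the line <[w]> of F^3, and the line joining two
   points is the sum of the corresponding subspaces. *)
Definition plane_config (u : 'I_n -> 'cV[F]_3) (v : 'I_n.-1 -> 'cV[F]_3) :=
  [/\ forall i, u i != 0,
      injective (fun i => <[u i]>%VS),
      forall i, v i != 0
    & forall i : 'I_n.-1,
        ~~ (<[v i]> <= <[u (widen_ord (leq_pred n) i)]>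
                       + <[u (Ordinal (succ_subproof i))]>)%VS].

End Construction.

(* n <= |F|^2 + |F| + 1, which holds vacuously when F is infinite. *)
Definition le_card_PG2 (F : fieldType) (n : nat) : Prop :=
  forall s : seq F, uniq s -> (forall x, x \in s) ->
    (n <= size s ^ 2 + size s + 1)%N.

(* Main.v *)
Require Import Defs.
From HB Require Import structures.
From Stdlib Require Import Classical.
From mathcomp Require Import all_boot all_order all_algebra all_field.
From mathcomp Require Import zify.

Set Implicit Arguments.
Unset Strict Implicit.
Unset Printing Implicit Defensive.

Import Order.TTheory GRing.Theory Num.Theory.
Local Open Scope ring_scope.

(* The code is the kernel on U(n, F) of the syndrome map sending E_ii to u_i,
   E_(i,i+1) to v_i and the other matrix units to 0.  This map is onto F^3,
   whence the dimension.  An upper triangular matrix of weight at most 2 has at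
   most two nonzero blocks M_[k], so it is a E_ii + b E_ij + c E_jj with b = 0
   unless j = i + 1; its syndrome vanishes only if a = b = c = 0, since the u_i
   are distinct points and v_i is off the line through u_i and u_(i+1).
   Conversely, any code C with these parameters yields n distinct points of the
   projective plane of the 3-dimensional space U / C, namely the classes of the
   E_ii. *)

(** * Dimension of matrix spaces with prescribed support *)

Section SupportDimension.
Variables (F : fieldType) (n : nat) (P : rel 'I_n).

Definition supp_row (M : 'M[F]_n) : 'rV[F]_#|[pred p | P p.1 p.2]| :=
  \row_k M (enum_val k).1 (enum_val k).2.

Fact supp_row_is_linear : linear supp_row.
Proof. by move=> a M N; apply/rowP=> k; rewrite !mxE. Qed.
HB.instance Definition _ :=
  GRing.isLinear.Build F 'M[F]_n 'rV[F]__ _ supp_row supp_row_is_linear.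

(** Reading off the entries at the positions allowed by [P] is injective on this space, and onto
    since each row lifts to a combination of matrix units. *)
Lemma dim_mxsupp : \dim (mxsupp F P) = #|[pred p | P p.1 p.2]|.
Proof.
have ker0 : (mxsupp F P :&: lker (linfun supp_row) = 0)%VS.
  apply/eqP; rewrite -subv0; apply/subvP=> M; rewrite memv_cap memv0.
  case/andP=> /mxsuppP suppM; rewrite memv_ker lfunE /= => /eqP M0.
  apply/eqP/matrixP=> i j; rewrite [RHS]mxE; have [Pij|/suppM//] := boolP (P i j).
  have Sij : (i, j) \in [pred p | P p.1 p.2] by [].
  by have /rowP/(_ (enum_rank_in Sij (i, j))) := M0; rewrite !mxE enum_rankK_in.
rewrite -(limg_dim_eq ker0).
suff -> : (linfun supp_row @: mxsupp F P = fullv)%VS.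
  by rewrite dimvf dim_matrix mul1r.
apply/eqP; rewrite eqEsubv subvf; apply/subvP=> r _; apply/memv_imgP.
exists (\sum_k r 0 k *: delta_mx (enum_val k).1 (enum_val k).2).
  apply/mxsuppP=> i j nPij; rewrite summxE big1 // => k _; rewrite !mxE.
  case: eqP => [ik|_]; last by rewrite mulr0.
  case: eqP => [jk|_]; last by rewrite mulr0.
  by have := enum_valP k; rewrite inE -ik -jk (negPf nPij).
apply/rowP=> k; rewrite lfunE /= mxE summxE (bigD1 k) //= !mxE !eqxx mulr1.
rewrite big1 ?addr0 // => l ne_lk; rewrite !mxE -[_ && _]/(enum_val k == enum_val l).
by rewrite (inj_eq enum_val_inj) eq_sym (negPf ne_lk) mulr0.
Qed.

End SupportDimension.

Lemma dim_upper_mx (F : fieldType) n :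
  \dim (upper_mx F n) = ((n * (n + 1)) %/ 2)%N.
Proof.
rewrite dim_mxsupp -sum1_card -(pair_big_dep predT (fun i j : 'I_n => i <= j)%N
  (fun _ _ => 1%N)) /= (exchange_big_dep predT) //=.
(* Count by columns: column [j] has the [j.+1] positions on or above the diagonal. *)
transitivity (\sum_(j < n) j.+1)%N.
  apply: eq_bigr => j _; rewrite sum1_card.
  rewrite -(card_ord j.+1) -(card_image (f := widen_ord (ltn_ord j))); last first.
    by move=> a b /(congr1 val)/= eq_ab; apply: val_inj.
  apply: eq_card => i; rewrite unfold_in; apply/idP/imageP=> [le_ij | [a _ ->]].
    by exists (Ordinal (le_ij : (i < j.+1)%N)) => //; apply: val_inj.
  exact: (ltn_ord a).
elim: n => [|n IHn]; first by rewrite big_ord0.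
by rewrite big_ord_recr /= IHn; lia.
Qed.

(** * Flag-rank weight and the upper triangular matrices of weight at most 2 *)

Section Weight.
Variables (F : fieldType) (n : nat).
Implicit Types M N : 'M[F]_n.

Lemma flag_rank_weightD M N :
  (flag_rank_weight (M + N) <= flag_rank_weight M + flag_rank_weight N)%N.
Proof.
rewrite /flag_rank_weight -big_split /=; apply: leq_sum => k _.
apply: leq_trans (mxrank_add _ _).
by rewrite (_ : flag_block _ _ = flag_block M k + flag_block N k) //;
   apply/matrixP=> a b; rewrite !mxE.
Qed.

(** Block [k] is a column times a row, hence of rank at most 1, and it vanishes unless
    [i <= k <= j]. *)
Lemma flag_rank_weight_delta (c : F) (i j : 'I_n) :
  (flag_rank_weight (c *: delta_mx i j) <= (j - i).+1)%N.
Proof.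
have rank_le (k : 'I_n) :
    (\rank (flag_block (c *: delta_mx i j) k) <= (i <= k <= j))%N.
  case: (boolP (_ <= _ <= _)%N) => [_ | out].
    rewrite (_ : flag_block _ k =
        (\col_a (c *+ (widen_ord (ltn_ord k) a == i)))
        *m (\row_b ((Ordinal (flag_col_subproof b) == j)%:R : F))).
      exact: mulmx_max_rank.
    apply/matrixP=> a b; rewrite !mxE big_ord1 !mxE.
    by case: (_ == i); rewrite /= ?mulr1n ?mulr0n ?mul0r ?mulr0.
  rewrite (_ : flag_block _ k = 0) ?mxrank0 //; apply/matrixP=> a b.
  rewrite !mxE; case: eqP => [/(congr1 val)/= ia|_]; last by rewrite mulr0.
  case: eqP => [/(congr1 val)/= jb|_]; last by rewrite mulr0.
  by move: out; rewrite -ia -jb -ltnS ltn_ord leq_addr.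
apply: (@leq_trans (\sum_(k < n) (i <= k <= j))).
  by apply: leq_sum => k _; apply: rank_le.
rewrite -big_mkcond sum1_card cardE -(size_map val).
rewrite -[X in (_ <= X)%N](size_iota i); apply: uniq_leq_size.
  by rewrite (map_inj_uniq val_inj) enum_uniq.
move=> l /mapP[k]; rewrite mem_enum unfold_in mem_iota => le_ikj ->.
by move: le_ikj => /=; lia.
Qed.

(** Each nonzero block costs at least 1, so at most two blocks are nonzero. A nonzero entry at (a,
    b) makes all blocks from [a] to [b] nonzero, so its row and column indices both lie in that set
    of at most two indices. *)
Lemma light_upper_mx M :
  (1 < n)%N -> M \in upper_mx F n -> M != 0 -> (flag_rank_weight M < 3)%N ->
  exists i j : 'I_n, [/\ (i < j)%N,
    M = M i i *: delta_mx i i + M i j *: delta_mx i j + M j j *: delta_mx j j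
    & M i j != 0 -> j = i.+1 :> nat].
Proof.
move=> n_gt1 /mxsuppP upM nzM wtM.
pose Z := [set k | flag_block M k != 0].
have cardZ : (#|Z| < 3)%N.
  apply: leq_ltn_trans wtM; rewrite -sum1_card big_mkcond /=.
  by apply: leq_sum => k _; rewrite inE -mxrank_eq0; case: (\rank _).
have memZ (a b k : 'I_n) : M a b != 0 -> (a <= k <= b)%N -> k \in Z.
  move=> nzMab /andP[le_ak le_kb]; rewrite inE; apply: contra nzMab => /eqP/matrixP.
  have lt_bk : (b - k < n - k)%N by rewrite ltn_sub2r.
  move/(_ (Ordinal (le_ak : (a < k.+1)%N)) (Ordinal lt_bk)); rewrite !mxE => <-.
  by apply/eqP; congr (M _ _); apply: val_inj; rewrite //= subnKC.
have diagZ (a b : 'I_n) : M a b != 0 -> [/\ (a <= b)%N, a \in Z & b \in Z].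
  move=> nzMab; have le_ab : (a <= b)%N by apply: contraNT nzMab => /upM->.
  by split=> //; apply: memZ nzMab _; rewrite leqnn ?le_ab.
have [i [j [lt_ij ZE]]] :
    exists i j : 'I_n, (i < j)%N /\ forall k, k \in Z -> (k == i) || (k == j).
  have [i Zi] : exists i, i \in Z.
    apply/existsP; apply: contraNT nzM; rewrite negb_exists => /forallP Z0.
    apply/eqP/matrixP=> a b; rewrite mxE; apply/eqP.
    by apply: contraNT (Z0 a) => /diagZ[].
  have [j [ne_ij ZE]] :
      exists j, i != j /\ forall k, k \in Z -> (k == i) || (k == j).
    have [|Z1] := boolP [exists j in Z, i != j].
      case/exists_inP=> j Zj ne_ij; exists j; split=> // k Zk.
      apply: contraTT cardZ; rewrite negb_or => /andP[ne_ki ne_kj].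
      rewrite -leqNgt; apply/card_gt2P.
      by exists i, j, k; rewrite Zi Zj Zk ne_ij ne_ki eq_sym ne_kj.
    (* Here only block [i] is nonzero, so any other index can serve as [j]; [n_gt1] supplies one. *)
    have [j ne_ij] : exists j : 'I_n, i != j.
      have n_gt0 := ltnW n_gt1.
      have [i0|] := eqVneq i (Ordinal n_gt0); last by exists (Ordinal n_gt0).
      by exists (Ordinal n_gt1); rewrite i0.
    exists j; split=> // k Zk; move: Z1; rewrite negb_exists => /forallP/(_ k).
    by rewrite Zk /= negbK eq_sym => ->.
  have [lt_ij | lt_ji | eq_ij] := ltngtP i j; first by exists i, j.
    by exists j, i; split=> // k /ZE; rewrite orbC.
  by rewrite (val_inj eq_ij) eqxx in ne_ij.
exists i, j; split=> // [|nzMij].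
  have ne_ji : (j == i) = false by apply: gtn_eqF.
  have ne_ij : (i == j) = false by apply: ltn_eqF.
  apply/matrixP=> a b; rewrite !mxE.
  have [M0|/diagZ[le_ab /ZE/orP[]/eqP Ea /ZE/orP[]/eqP Eb]] := eqVneq (M a b) 0;
    last first.
  - by rewrite Ea Eb ne_ji eqxx /= !mulr0 mulr1 !add0r.
  - by move: le_ab; rewrite Ea Eb leqNgt lt_ij.
  - by rewrite Ea Eb ne_ji ne_ij !eqxx /= !mulr0 mulr1 !add0r addr0.
  - by rewrite Ea Eb ne_ij !eqxx /= !mulr0 mulr1 !addr0.
  have term0 c d : M c d * ((a == c) && (b == d))%:R = 0.
    by case: eqP => [<-|]; case: eqP => [<-|]; rewrite ?M0 ?mul0r ?mulr0.
  by rewrite M0 !term0 !addr0.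
(* A nonzero entry at (i, j) also makes block [i.+1] nonzero, which forces [i.+1] to be [j]. *)
have lt_i1 : (i.+1 < n)%N by apply: leq_ltn_trans (ltn_ord j).
have /ZE/orP[/eqP/(congr1 val)|/eqP/(congr1 val)] :
    Ordinal lt_i1 \in Z by apply: (memZ i j); rewrite //= leqnSn.
  by move=> /=; lia.
by move=> /=.
Qed.

End Weight.

(** * Lines in a vector space *)

Section Lines.
Variables (F : fieldType) (vT : vectType F).
Implicit Types (w : vT) (V : {vspace vT}).

Lemma scaled_line w w' c : w != 0 -> w = c *: w' -> <[w]>%VS = <[w']>%VS.
Proof.
move=> nzw Ew; have nzc : c != 0 by apply: contraNneq nzw => c0; rewrite Ew c0 scale0r.
apply/eqP; rewrite eqEsubv -!memvE; apply/andP; split; apply/vlineP.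
  by exists c.
by exists c^-1; rewrite Ew scalerA mulVf ?scale1r.
Qed.

Lemma dim_add_line V w : w \notin V -> \dim (V + <[w]>) = (\dim V).+1.
Proof.
move=> Vw; have nzw : w != 0 by apply: contraNneq Vw => ->; apply: mem0v.
rewrite dimv_disjoint_sum ?dim_vline ?nzw ?addn1 //.
apply/eqP; rewrite -subv0; apply/subvP=> x; rewrite memv_cap memv0.
case/andP=> Vx /vlineP[c Ex]; apply: contraNT Vw; rewrite Ex scaler_eq0 negb_or.
by case/andP=> nzc _; rewrite -[w]scale1r -(mulVf nzc) -scalerA -Ex memvZ.
Qed.

End Lines.

(** * The syndrome map and the constructed code *)

Section Syndrome.
Variables (F : fieldType) (n : nat).
Implicit Type H : 'M[F]_(3, 2 * n - 1).

(** Defined on all matrices, not only on D(2, n, F), so that both summands of the code fit into a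
    single kernel. *)
Definition syndrome H : 'Hom('M[F]_n, 'cV[F]_3) :=
  linfun (mulmx H \o trmx \o @rho F n).

Lemma syndromeE H M : syndrome H M = H *m (rho M)^T.
Proof. by rewrite lfunE. Qed.

Lemma eq_rho (M N : 'M[F]_n) :
  (forall i j : 'I_n, (i <= j < i + 2)%N -> M i j = N i j) -> rho M = rho N.
Proof. by move=> eqMN; apply/rowP=> k; rewrite !mxE eqMN //=; lia. Qed.

Lemma syndrome_delta H (i j : 'I_n) (k : 'I_(2 * n - 1)) :
  k./2 = i -> uphalf k = j -> syndrome H (delta_mx i j) = col k H.
Proof.
move=> ki kj; rewrite syndromeE colE -(trmx_delta _ 0 k); congr (_ *m _^T).
(* An index is the sum of its lower and upper halves, so this pair determines it. *)
apply/rowP=> l; rewrite !mxE -!val_eqE /= -ki -kj; congr (nat_of_bool _)%:R.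
lia.
Qed.

Variables (u : 'I_n -> 'cV[F]_3) (v : 'I_n.-1 -> 'cV[F]_3).
Let s := syndrome (check_mx u v).

Lemma syndrome_diag (i : 'I_n) : s (delta_mx i i) = u i.
Proof.
have lt_k : (2 * i < 2 * n - 1)%N by have := ltn_ord i; lia.
by rewrite -(@check_mx_even F n u v i (Ordinal lt_k)) //; apply: syndrome_delta => /=; lia.
Qed.

Lemma syndrome_offdiag (i : 'I_n.-1) :
  s (delta_mx (widen_ord (leq_pred n) i) (Ordinal (succ_subproof i))) = v i.
Proof.
have lt_k : (2 * i + 1 < 2 * n - 1)%N by have := ltn_ord i; lia.
by rewrite -(@check_mx_odd F n u v i (Ordinal lt_k)) //; apply: syndrome_delta => /=; lia.
Qed.

(** [phi13] shifts columns by two, turning the support condition [i <= j] into [i + 2 <= j]; rows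
    from [n - 2] on and columns below 2 contain no such position. *)
Lemma phi13_upperP (M : 'M[F]_n) :
  reflect (forall i j : 'I_n, ~~ (i + 2 <= j)%N -> M i j = 0)
          (M \in (linfun (@phi13 F n) @: upper_mx F (n - 2))%VS).
Proof.
apply: (iffP memv_imgP) => [[B /mxsuppP upB ->] i j nle_ij | M0].
  rewrite lfunE /=; have [|] := boolP ((n - 2 <= i) || (j < 2))%N.
    exact: phi13_out.
  rewrite negb_or -ltnNge -leqNgt => /andP[lt_i le_j].
  have lt_j : (j - 2 < n - 2)%N by have := ltn_ord j; lia.
  rewrite (_ : i = widen_ord (leq_subr 2 n) (Ordinal lt_i)); last exact: val_inj.
  rewrite (_ : j = Ordinal (phi_col_subproof (Ordinal lt_j))); last first.
    by apply: val_inj; rewrite /= subnKC.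
  by rewrite phi13E upB //=; move: nle_ij; lia.
pose B := \matrix_(i < n - 2, j < n - 2)
  M (widen_ord (leq_subr 2 n) i) (Ordinal (phi_col_subproof j)).
exists B; first by apply/mxsuppP=> i j nle_ij; rewrite mxE M0 //=; move: nle_ij; lia.
apply/matrixP=> i j; rewrite lfunE /=.
have [out|] := boolP ((n - 2 <= i) || (j < 2))%N.
  by rewrite phi13_out // M0 //; have := ltn_ord j; move: out; lia.
rewrite negb_or -ltnNge -leqNgt => /andP[lt_i le_j].
have lt_j : (j - 2 < n - 2)%N by have := ltn_ord j; lia.
rewrite (_ : i = widen_ord (leq_subr 2 n) (Ordinal lt_i)); last exact: val_inj.
rewrite (_ : j = Ordinal (phi_col_subproof (Ordinal lt_j))); last first.
  by apply: val_inj; rewrite /= subnKC.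
by rewrite phi13E mxE.
Qed.

Let A := rho_preim (checked_by (check_mx u v)).
Let B := (linfun (@phi13 F n) @: upper_mx F (n - 2))%VS.

Lemma memv_rho_preim (M : 'M[F]_n) : (M \in A) = (M \in bidiag_mx F n) && (s M == 0).
Proof.
by rewrite memv_cap -memv_preim checked_byE lfunE /= /s syndromeE.
Qed.

(** The supports are disjoint: [j < i + 2] for the first summand, [i + 2 <= j] for the second. *)
Lemma construction_direct : directv (A + B).
Proof.
apply/directv_addP/eqP; rewrite -subv0; apply/subvP=> M.
rewrite memv_cap memv_rho_preim memv0 => /andP[/andP[/mxsuppP bdM _] /phi13_upperP upM].
apply/eqP/matrixP=> i j; rewrite [RHS]mxE.
by have [le_ij|/upM//] := boolP (i + 2 <= j)%N; apply: bdM; lia.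
Qed.

Lemma constructionE : (A + B = upper_mx F n :&: lker s)%VS.
Proof.
apply/eqP; rewrite eqEsubv subv_add -andbA; apply/and3P; split; apply/subvP=> M.
- rewrite memv_rho_preim memv_cap [M \in lker s]memv_ker => /andP[/mxsuppP bdM ->]; rewrite andbT.
  by apply/mxsuppP=> i j nle_ij; apply: bdM; lia.
- move/phi13_upperP=> upM; rewrite memv_cap [M \in lker s]memv_ker; apply/andP; split.
    by apply/mxsuppP=> i j nle_ij; apply: upM; lia.
  rewrite /s syndromeE (@eq_rho _ 0) ?raddf0 ?trmx0 ?mulmx0 // => i j le_ij.
  by rewrite mxE upM //; lia.
rewrite memv_cap [M \in lker s]memv_ker => /andP[/mxsuppP upM sM0].
(* [off_support P] erases the positions where [P] holds, so it keeps the two diagonals read by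
   [rho]. This part has the syndrome of [M], and the remainder lies in the image of [phi13]. *)
pose P : rel 'I_n := fun i j => ~~ (i <= j < i + 2)%N.
rewrite -(subrK (off_support P M) M) addrC; apply: memv_add.
  rewrite memv_rho_preim; apply/andP; split.
    by apply/mxsuppP=> i j out; rewrite !mxE /P out.
  move: sM0; rewrite /s !syndromeE (@eq_rho (off_support P M) M) // => i j bd.
  by rewrite mxE /P bd.
apply/phi13_upperP=> i j nle; rewrite !mxE /P; case: ifPn; rewrite ?subrr // => out.
by rewrite subr0; apply: upM; move: nle out; lia.
Qed.

Hypotheses (n_ge3 : (3 <= n)%N) (uv_config : plane_config u v).

(** Dividing by a nonzero [a] would make [u i] a multiple of [u j], so the two points would
    coincide. *)
Lemma points_independent (i j : 'I_n) a c :
  i != j -> a *: u i + c *: u j = 0 -> a = 0.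
Proof.
move=> ne_ij /eqP; rewrite addr_eq0 => /eqP rel; have [nzu inj_u _ _] := uv_config.
apply: contraNeq ne_ij => nza; apply/eqP/inj_u.
apply: (@scaled_line _ _ _ _ (- (a^-1 * c))) => //.
by rewrite scaleNr -scalerA -scalerN -rel scalerA mulVf // scale1r.
Qed.

(** Dividing by a nonzero [b] would put [v i] on the line through the two consecutive points. *)
Lemma off_line_independent (i : 'I_n.-1) a b c :
  a *: u (widen_ord (leq_pred n) i) + b *: v i
    + c *: u (Ordinal (succ_subproof i)) = 0 -> b = 0.
Proof.
have [_ _ _ /(_ i)] := uv_config; set x := u _; set y := u _ => off_xy.
rewrite addrAC => /eqP; rewrite addrC addr_eq0 => /eqP rel.
apply: contraNeq off_xy => nzb; rewrite -memvE.
rewrite -[v i]scale1r -(mulVf nzb) -scalerA rel memvZ // memvN.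
by rewrite memv_add // memvZ // memv_line.
Qed.

Lemma dim_construction : \dim (A + B)%VS = ((n * (n + 1)) %/ 2 - 3)%N.
Proof.
suff dims : \dim (s @: upper_mx F n) = 3%N.
  by rewrite constructionE -(dim_upper_mx F) -(limg_ker_dim s (upper_mx F n)) dims addnK.
apply/eqP; rewrite eqn_leq; apply/andP; split.
  rewrite -[X in (_ <= X)%N](_ : \dim {:'cV[F]_3} = 3%N) ?dimvS ?subvf //.
  by rewrite dimvf dim_matrix.
(* For surjectivity, the syndromes of E_00, E_01 and E_11 suffice: they are two distinct points and
   a point off their line. *)
have lt_0 : (0 < n.-1)%N by lia.
pose i := Ordinal lt_0; have [nzu inj_u _ /(_ i)] := uv_config.
set x := u _; set y := u _; rewrite -memvE => off_xy.
have ndxy : y \notin <[x]>%VS.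
  apply/negP=> /vlineP[c Ey].
  by have /inj_u/(congr1 val) := scaled_line (nzu _) Ey.
have dim3 : \dim (<[x]> + <[y]> + <[v i]>) = 3%N.
  by rewrite !dim_add_line // dim_vline nzu.
have delta_up (a b : 'I_n) : (a <= b)%N -> delta_mx a b \in upper_mx F n.
  move=> le_ab; apply/mxsuppP=> c d; rewrite mxE; do 2!case: eqP => //= ->.
  by rewrite le_ab.
apply: leq_trans (eq_leq (esym dim3)) _; apply: dimvS; rewrite !subv_add -!memvE /x /y -!syndrome_diag -syndrome_offdiag.
by rewrite !memv_img ?delta_up //=.
Qed.

Lemma construction_weight (M : 'M[F]_n) :
  M \in (A + B)%VS -> M != 0 -> (3 <= flag_rank_weight M)%N.
Proof.
rewrite constructionE memv_cap [M \in lker s]memv_ker => /andP[upM /eqP sM0] nzM.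
rewrite leqNgt; apply: contra (nzM) => wtM.
have [|i [j [lt_ij EM adj]]] := light_upper_mx _ upM nzM wtM; first by lia.
have ne_ij : i != j by rewrite neq_ltn lt_ij.
have rel := sM0; rewrite EM !linearD !linearZ /= !syndrome_diag in rel.
(* The middle term goes first: once it is gone, the relation only involves two distinct points and
   each remaining coefficient vanishes. *)
have Mij0 : M i j = 0.
  apply/eqP; apply: contraT => nzMij; have Ej := adj nzMij.
  have lt_i : (i < n.-1)%N by have := ltn_ord j; lia.
  pose i' := Ordinal lt_i.
  have Ei : i = widen_ord (leq_pred n) i' by apply: val_inj.
  have Ej' : j = Ordinal (succ_subproof i') by apply: val_inj.
  move: i' Ei Ej' => i' Ei Ej'; rewrite Ei Ej' in rel nzMij.
  rewrite syndrome_offdiag in rel.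
  by rewrite (off_line_independent rel) eqxx in nzMij.
rewrite Mij0 scale0r addr0 in rel.
have Mii0 := points_independent ne_ij rel.
rewrite addrC in rel; rewrite eq_sym in ne_ij.
rewrite Mii0 Mij0 (points_independent ne_ij rel) !scale0r !addr0 in EM.
by rewrite EM eqxx.
Qed.

Lemma construction_MFRD : is_MFRD ((n * (n + 1)) %/ 2 - 3) 3 (A + B)%VS.
Proof.
split; last by rewrite mfrd_defect3.
split; [by rewrite constructionE capvSl | exact: dim_construction |
  | exact: construction_weight].
have lt_0 : (0 < n)%N by lia.
(* Weight 3 is attained by E_02, which meets only blocks 0, 1, 2 and lies in the image of [phi13];
   [n_ge3] reads [2 < n], so [Ordinal n_ge3] is index 2. *)
pose M : 'M[F]_n := delta_mx (Ordinal lt_0) (Ordinal n_ge3).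
have nzM : M != 0.
  by apply/eqP=> /matrixP/(_ (Ordinal lt_0) (Ordinal n_ge3))/eqP; rewrite !mxE !eqxx oner_eq0.
have CM : M \in (A + B)%VS.
  apply/(subvP (addvSr A B))/phi13_upperP=> i j nle_ij; rewrite mxE.
  do 2!case: eqP => //= ?; subst; by rewrite /= in nle_ij.
exists M; split=> //; apply/eqP; rewrite eqn_leq construction_weight // andbT.
by rewrite -[M]scale1r; apply: leq_trans (flag_rank_weight_delta _ _ _) _.
Qed.

End Syndrome.

(** * Normalized coordinates on the projective plane *)

Section ProjectivePlane.
Variable F : fieldType.
Implicit Types (w : 'cV[F]_3) (s : seq F).

Definition coord3 (x y z : F) : 'cV[F]_3 := \col_k [:: x; y; z]`_k.

(** The first nonzero coordinate, or 0 when [w] is 0. *)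
Definition pivot w : F :=
  if w 0 0 != 0 then w 0 0 else if w 1 0 != 0 then w 1 0 else w 2 0.

Definition normalize w : 'cV[F]_3 := (pivot w)^-1 *: w.

(** The vectors with pivot 1 and remaining free coordinates in [s]. They represent every point once
    when [s] enumerates the field; a general [s] also serves infinite fields. *)
Definition normal_points s : seq 'cV[F]_3 :=
  coord3 0 0 1 :: [seq coord3 0 1 a | a <- s]
    ++ [seq coord3 1 a b | a <- s, b <- s].

Lemma coord3_eta w : w = coord3 (w 0 0) (w 1 0) (w 2 0).
Proof.
apply/colP=> k; rewrite mxE.
by case: k => [[|[|[|//]]] lt_k] /=; congr (w _ _); apply: val_inj.
Qed.

Lemma coord3_inj x y z x' y' z' :
  coord3 x y z = coord3 x' y' z' -> [/\ x = x', y = y' & z = z'].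
Proof.
by move/colP=> eq3; have := eq3 0; have := eq3 1; have := eq3 2; rewrite !mxE.
Qed.

Lemma pivot_eq0 w : (pivot w == 0) = (w == 0).
Proof.
apply/eqP/eqP=> [|->]; last by rewrite /pivot !mxE eqxx.
rewrite /pivot; case: (eqVneq (w 0 0)) => [x0|/eqP//] /=.
case: (eqVneq (w 1 0)) => [y0|/eqP//] /= z0; rewrite [w]coord3_eta x0 y0 z0.
by apply/colP=> k; rewrite !mxE; case: k => [[|[|[|//]]] lt_k].
Qed.

Lemma normalizeZ c w : c != 0 -> normalize (c *: w) = normalize w.
Proof.
move=> nzc; rewrite /normalize scalerA; congr (_ *: _).
have -> : pivot (c *: w) = c * pivot w.
  by rewrite /pivot !mxE !mulf_eq0 (negPf nzc) /=; do 2!case: ifP => // _.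
by rewrite invfM mulrAC mulVf // mul1r.
Qed.

(** With [normalizeZ], this makes [normalize] a complete invariant of the point [w]; the factor is
    the quotient of the pivots. *)
Lemma eq_normalize w w' :
  w != 0 -> w' != 0 -> normalize w = normalize w' -> exists c, w = c *: w'.
Proof.
move=> nzw nzw' Enorm; exists (pivot w * (pivot w')^-1).
rewrite -scalerA -[_ *: w']/(normalize w') -Enorm scalerA divff ?scale1r //.
by rewrite pivot_eq0.
Qed.

Lemma size_normal_points s :
  size (normal_points s) = (size s ^ 2 + size s + 1)%N.
Proof. by rewrite /= size_cat size_map size_allpairs mulnn; lia. Qed.

Lemma uniq_normal_points s : uniq s -> uniq (normal_points s).
Proof.
move=> Us; rewrite /= mem_cat cat_uniq negb_or -!andbA; apply/and5P; split.
- by apply/mapP=> -[a _ /coord3_inj[_ /esym/eqP]]; rewrite oner_eq0.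
- by apply/allpairsP=> -[[a b] [_ _ /coord3_inj[/esym/eqP]]]; rewrite oner_eq0.
- by rewrite map_inj_uniq // => a b /coord3_inj[].
- apply/hasPn=> _ /allpairsP[[a b] [_ _ ->]].
  by apply/mapP=> -[c _ /coord3_inj[/eqP]]; rewrite oner_eq0.
by apply: allpairs_uniq => // -[a b] [c d] _ _ /= /coord3_inj[_ -> ->].
Qed.

Lemma normal_points_normal s w :
  w \in normal_points s -> w != 0 /\ normalize w = w.
Proof.
suff pivot1 : w \in normal_points s -> pivot w = 1.
  move=> /pivot1 w1; rewrite -pivot_eq0 /normalize w1 invr1 scale1r.
  by rewrite oner_eq0.
rewrite inE mem_cat => /or3P[/eqP-> | /mapP[a _ ->] | /allpairsP[[a b] [_ _ ->]]];
  by rewrite /pivot !mxE /= ?eqxx ?oner_eq0.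
Qed.

Lemma normalize_in_normal_points s w :
  (forall x, x \in s) -> w != 0 -> normalize w \in normal_points s.
Proof.
move=> all_s; rewrite -pivot_eq0 /normalize inE mem_cat => nzp.
rewrite [w in _ *: w]coord3_eta.
have -> c x y z : c *: coord3 x y z = coord3 (c * x) (c * y) (c * z).
  by apply/colP=> k; rewrite !mxE; case: k => [[|[|[|//]]] lt_k].
move: nzp; rewrite /pivot.
case: (eqVneq (w 0 0)) => [->|nzx _] /=; last first.
  apply/orP; right; apply/orP; right; apply/allpairsP.
  exists ((w 0 0)^-1 * w 1 0, (w 0 0)^-1 * w 2 0).
  by rewrite mulVf //; split; rewrite ?all_s.
case: (eqVneq (w 1 0)) => [->|nzy _] /= => [nzz|].
  by rewrite !mulr0 mulVf ?eqxx.
apply/orP; right; apply/orP; left; apply/mapP.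
by exists ((w 1 0)^-1 * w 2 0); rewrite ?all_s // mulr0 mulVf.
Qed.

(* If F admits no complete enumeration, one can pick arbitrarily many scalars. *)
Lemma le_card_PG2_scalars n : le_card_PG2 F n ->
  exists2 s : seq F, uniq s & (n <= size s ^ 2 + size s + 1)%N.
Proof.
move=> le_n; have [[s Us all_s] | noenum] :=
  classic (exists2 s : seq F, uniq s & forall x, x \in s).
  by exists s; last exact: le_n.
suff [s Us <-] : exists2 s : seq F, uniq s & size s = n by exists s => //; lia.
elim: n {le_n} => [|k [s Us <-]]; first by exists [::].
have [x s'x] : exists x, x \notin s.
  apply: NNPP => nex; apply: noenum; exists s => // x.
  by apply: contraT => s'x; case: nex; exists x.
by exists (x :: s); rewrite //= s'x.
Qed.

Lemma plane_config_exists n : le_card_PG2 F n ->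
  exists (u : 'I_n -> 'cV[F]_3) (v : 'I_n.-1 -> 'cV[F]_3), plane_config u v.
Proof.
case/le_card_PG2_scalars=> s Us; rewrite -size_normal_points => le_n.
(* The points are the first [n] of the list. Each [v i] is picked in a complement of the line, which
   is nonzero because the line has dimension at most 2 in F^3. *)
pose u (i : 'I_n) := nth 0 (normal_points s) i.
have lt_i (i : 'I_n) : (i < size (normal_points s))%N by apply: leq_trans le_n.
have u_normal i : u i != 0 /\ normalize (u i) = u i.
  exact/normal_points_normal/mem_nth/lt_i.
pose L (i : 'I_n.-1) := (<[u (widen_ord (leq_pred n) i)]>
                         + <[u (Ordinal (succ_subproof i))]>)%VS.
exists u, (fun i => vpick (L i)^C%VS).
have nzv i : vpick (L i)^C%VS != 0.
  rewrite vpick0 -dimv_eq0 dimv_compl dimvf dim_matrix subn_eq0 -ltnNge.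
  rewrite ltnS; apply: leq_trans (dimv_add_leqif _ _) _.
  by rewrite !dim_vline; case: (_ != 0); case: (_ != 0).
split=> // [i | i j /= eq_ij | i].
- by case: (u_normal i).
- have /vlineP[c Eu] : u i \in <[u j]>%VS by rewrite -eq_ij memv_line.
  have nzc : c != 0.
    by apply: contraNneq (u_normal i).1 => c0; rewrite Eu c0 scale0r.
  (* Proportional normalized vectors are equal, so the positions agree in a list without
     repetition. *)
  have := (u_normal i).2; rewrite Eu normalizeZ // (u_normal j).2 -Eu => /eqP.
  by rewrite nth_uniq ?uniq_normal_points // => /eqP/val_inj/esym.
rewrite -memvE; apply: contra (nzv i) => Lv.
by rewrite -memv0 -(capv_compl (L i)) memv_cap Lv memv_pick.
Qed.

End ProjectivePlane.

(** * The bound on [n] for an arbitrary code *)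

Lemma flag_rank_code_le_card (F : fieldType) n (C : {vspace 'M[F]_n}) :
  (3 <= n)%N -> is_flag_rank_code ((n * (n + 1)) %/ 2 - 3) 3 C ->
  le_card_PG2 F n.
Proof.
move=> n_ge3 [subCU dimC _ minC] s Us all_s.
(* f has kernel C, so that W is a model of U / C. *)
pose f : 'End('M[F]_n) := (\1 - projv C)%VF.
have kerf : lker f = C.
  apply/eqP; rewrite eqEsubv; apply/andP; split; apply/subvP=> M.
    rewrite memv_ker !lfunE /= !lfunE /= subr_eq0 => /eqP->; exact: memv_proj.
  by move=> CM; rewrite memv_ker !lfunE /= !lfunE /= projv_id // subrr.
pose W := (f @: upper_mx F n)%VS.
(* Rank-nullity; [n_ge3] makes the truncated subtraction of 3 exact. *)
have dimW : \dim W = 3%N.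
  have := limg_ker_dim f (upper_mx F n); rewrite kerf (capv_idPr subCU) dimC.
  by rewrite dim_upper_mx -/W; lia.
have [b basisW] : exists b : 3.-tuple _, basis_of W b.
  by move: (vbasis W) (vbasisP W); rewrite dimW => b; exists b.
have upE (i : 'I_n) : delta_mx i i \in upper_mx F n.
  apply/mxsuppP=> a c; rewrite mxE; do 2!case: eqP => //= ->.
  by rewrite leqnn.
pose q i : 'cV[F]_3 := \col_k coord b k (f (delta_mx i i)).
have q_rel i j a c : a *: q i + c *: q j = 0 ->
    a *: delta_mx i i + c *: delta_mx j j \in C.
  move=> rel; rewrite -kerf memv_ker linearD !linearZ /=.
  have Wf k : f (delta_mx k k) \in W by rewrite memv_img.
  rewrite (coord_basis basisW (Wf i)) (coord_basis basisW (Wf j)).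
  rewrite !scaler_sumr -big_split big1 // => k _.
  have /colP/(_ k) := rel; rewrite !mxE => relk.
  by rewrite /= !scalerA -scalerDl relk scale0r.
(* A relation between two classes gives a codeword a E_ii + c E_jj; its weight is at most 2, below
   the minimum distance, so it is 0. *)
have q_indep i j a c : a *: q i + c *: q j = 0 ->
    a *: delta_mx i i + c *: delta_mx j j = 0 :> 'M[F]_n.
  move/q_rel=> CM; apply/eqP; apply: contraT => nzM; suff : (3 <= 2)%N by [].
  apply: leq_trans (minC _ CM nzM) _; apply: leq_trans (flag_rank_weightD _ _) _.
  rewrite -[X in (_ <= X)%N]/(1 + 1)%N leq_add //.
    by rewrite (leq_trans (flag_rank_weight_delta _ _ _)) // subnn.
  by rewrite (leq_trans (flag_rank_weight_delta _ _ _)) // subnn.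
have nzq i : q i != 0.
  apply/eqP=> qi0; have /q_indep/matrixP/(_ i i)/eqP : 1 *: q i + 0 *: q i = 0.
    by rewrite qi0 !scaler0 addr0.
  by rewrite !mxE !eqxx mulr1 mul0r addr0 oner_eq0.
have inj_q : injective (fun i => normalize (q i)).
  move=> i j /(eq_normalize (nzq i) (nzq j))[c Eq].
  apply/eqP; apply: contraT => ne_ij.
  have /q_indep/matrixP/(_ i i)/eqP : 1 *: q i + - c *: q j = 0.
    by rewrite Eq scale1r scaleNr subrr.
  by rewrite !mxE !eqxx (negPf ne_ij) mulr1 mulr0 addr0 oner_eq0.
(* The [n] distinct normalized classes all occur in the list of points built from [s]. *)
rewrite -size_normal_points -[X in (X <= _)%N]card_ord cardE.
rewrite -(size_map (fun i => normalize (q i))); apply: uniq_leq_size.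
  by rewrite map_inj_uniq ?enum_uniq.
by move=> _ /mapP[i _ ->]; apply: normalize_in_normal_points.
Qed.

Theorem theorem4p22 (F : fieldType) (n : nat) (hn : (3 <= n)%N) :
  (le_card_PG2 F n ->
   forall (u : 'I_n -> 'cV[F]_3) (v : 'I_n.-1 -> 'cV[F]_3),
   plane_config u v ->
   let A := rho_preim (checked_by (check_mx u v)) in
   let B := (linfun (@phi13 F n) @: upper_mx F (n - 2))%VS in
   directv (A + B) /\ is_MFRD ((n * (n + 1)) %/ 2 - 3) 3 (A + B)%VS)
  /\
  ((exists C : {vspace 'M[F]_n}, is_MFRD ((n * (n + 1)) %/ 2 - 3) 3 C) <->
   le_card_PG2 F n).
Proof.
split=> [_ u v uv_config | ].
  by split; [exact: construction_direct | exact: construction_MFRD].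
split=> [[C [codeC _]] | le_n]; first exact: flag_rank_code_le_card codeC.
have [u [v uv_config]] := plane_config_exists le_n.
by eexists; apply: construction_MFRD uv_config.
Qed.
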